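(* Let $\mathcal L$ be a language in the logic of metric structures with a distinguished constant symbol $0$, and let $A_n$, $n\in\omega$, be $\mathcal L$-structures. Then the reduced product $\prod_n A_n/\bigoplus_n A_n$ corresponding to the Fréchet ideal is countably saturated.
   Context: Logic of metric structures: structures have sorts, each with bounded complete domains; function and predicate symbols have fixed moduli of uniform continuity on domains; formulas are built from atomic formulas by continuous real-valued connectives and the quantifiers $\sup$, $\inf$ over domains; every variable ranges over a fixed domain. Let $\prod_n A_n$ be the set of sequences $\bar x=(x_n)$ with $x_n\in A_n$ for all $n$ and all $x_n$ in the same domain, and $\bigoplus_n A_n=\{\bar x\in\prod_n A_n:\limsup_n d(x_n,0^{A_n})=0\}$. On the quotient $\mathcal A=\prod_n A_n/\bigoplus_n A_n$, with quotient map $q$ (so $q(\bar a)=q(\bar b)$ iff $\limsup_n d(a_n,b_n)=0$), the sorts are $q$-images of the sorts of $\prod_n A_n$, and one puts $d(q(\bar a),q(\bar b))=\limsup_n d(a_n,b_n)$, $R(q(\bar a))=\limsup_n R(a_n)$ for each predicate symbol $R$, and $f(q(\bar a))=q((f(a_n))_n)$ for each function symbol $f$. A condition over a structure $A$ is an expression $\phi(\bar x)=r$ with $\phi$ a formula, possibly with parameters from $A$, and $r\in\mathbb R$. A type over $A$ is a set of conditions over $A$ with free variables among a fixed finite tuple $\bar x$. It is realized in $A$ if some tuple $\bar a$ in $A$ of the appropriate sort satisfies $\phi(\bar a)^A=r$ for all its conditions. It is consistent if for every finite subset and every $\epsilon>0$ there is $\bar a$ in $A$ with $|\phi(\bar a)^A-r|\le\epsilon$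 for all conditions in the finite subset. $A$ is countably saturated if every consistent type over $A$ with countably many conditions is realized in $A$.
   Formalization: Any two domains of a sort are assumed to lie in a common domain, by an order that is part of the language; without this the functions on the reduced product need not be well defined. Domains are nonempty, with bounds fixed by the language. *)

(* Defs.v *)
From HB Require Import structures.
From mathcomp Require Import all_boot all_order all_algebra generic_quotient.
From mathcomp Require Import all_classical all_reals all_analysis.

Set Implicit Arguments.
Unset Strict Implicit.
Unset Printing Implicit Defensive.

Import Order.TTheory GRing.Theory Num.Theory.
Import numFieldNormedType.Exports.

Local Open Scope classical_set_scope.
Local Open Scope ring_scope.
Local Open Scope quotient_scope.

(* Bounds and moduli belong to the language, so they are common to all its
   structures.  The domains of a sort are directed; without this, two sequences
   taken in different domains could be at infinite distance, or be identified
   in the reduced product while their images under a symbol are not.  Constants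
   are function symbols of arity 0. *)
Record language (R : realType) := Language {
  lsort : Type;
  dom : lsort -> Type;
  dle : forall s, dom s -> dom s -> Prop;
  dle_directed : forall s (D1 D2 : dom s), exists D, dle D1 D /\ dle D2 D;
  dbound : forall s, dom s -> R;
  fsym : Type;
  farity : fsym -> nat;
  fsrc : forall f, 'I_(farity f) -> lsort;
  ftgt : fsym -> lsort;
  fdom : forall f, (forall i, dom (@fsrc f i)) -> dom (ftgt f);
  fmod : forall f, (forall i, dom (@fsrc f i)) -> R -> R;
  fmod_gt0 : forall f (D : forall i, dom (@fsrc f i)) e,
    0 < e -> 0 < fmod D e;
  psym : Type;
  parity : psym -> nat;
  psrc : forall p, 'I_(parity p) -> lsort;
  pbound : forall p, (forall i, dom (@psrc p i)) -> R;
  pmod : forall p, (forall i, dom (@psrc p i)) -> R -> R;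
  pmod_gt0 : forall p (D : forall i, dom (@psrc p i)) e,
    0 < e -> 0 < pmod D e;
  zero : fsym;
  zero_arity : farity zero = 0%N
}.

(* Domains are nonempty, so that the quantifiers [sup] and [inf] make sense. *)
Record structure (R : realType) (L : language R) := Structure {
  carrier : lsort L -> metricType R;
  sdom : forall s, dom s -> set (carrier s);
  fint : forall f : fsym L,
    (forall i, carrier (@fsrc R L f i)) -> carrier (ftgt f);
  pint : forall p : psym L, (forall i, carrier (@psrc R L p i)) -> R;
  sdom_cover : forall s (x : carrier s), exists D, @sdom s D x;
  sdom_nonempty : forall s (D : dom s), @sdom s D !=set0;
  sdom_le : forall s (D1 D2 : dom s), dle D1 D2 -> @sdom s D1 `<=` @sdom s D2;
  sdom_bounded : forall s (D : dom s) x y,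
    @sdom s D x -> @sdom s D y -> mdist x y <= dbound D;
  sdom_complete : forall s (D : dom s) (u : nat -> carrier s),
    (forall n, @sdom s D (u n)) -> cauchy (u @ \oo) ->
    exists2 l, @sdom s D l & u @ \oo --> l;
  fint_dom : forall f (D : forall i, dom (@fsrc R L f i)) a,
    (forall i, @sdom _ (D i) (a i)) -> @sdom _ (fdom D) (@fint f a);
  fint_unif : forall f (D : forall i, dom (@fsrc R L f i)) e a b, 0 < e ->
    (forall i, @sdom _ (D i) (a i)) -> (forall i, @sdom _ (D i) (b i)) ->
    (forall i, mdist (a i) (b i) < fmod D e) ->
    mdist (@fint f a) (@fint f b) <= e;
  pint_bounded : forall p (D : forall i, dom (@psrc R L p i)) a,
    (forall i, @sdom _ (D i) (a i)) -> `|@pint p a| <= pbound D;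
  pint_unif : forall p (D : forall i, dom (@psrc R L p i)) e a b, 0 < e ->
    (forall i, @sdom _ (D i) (a i)) -> (forall i, @sdom _ (D i) (b i)) ->
    (forall i, mdist (a i) (b i) < pmod D e) ->
    `|@pint p a - @pint p b| <= e
}.

Definition domain (R : realType) (L : language R) : Type :=
  {s : lsort L & dom s}.

(* Well-scoped de Bruijn variables: a context lists the domains over which the
   free variables range. *)
Inductive var (R : realType) (L : language R) :
    seq (domain L) -> lsort L -> Type :=
| vz (D : domain L) (G : seq (domain L)) : var (D :: G) (tag D)
| vs (D : domain L) (G : seq (domain L)) (s : lsort L) :
    var G s -> var (D :: G) s.

(* [P s] is the type of the parameters of sort [s]. *)
Inductive term (R : realType) (L : language R) (P : lsort L -> Type)
    (G : seq (domain L)) : lsort L -> Type :=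
| tvar s : var G s -> term P G s
| tpar s : P s -> term P G s
| tapp (f : fsym L) :
    (forall i, term P G (@fsrc R L f i)) -> term P G (ftgt f).

Inductive formula (R : realType) (L : language R) (P : lsort L -> Type)
    (G : seq (domain L)) : Type :=
| fdist s : term P G s -> term P G s -> formula P G
| fpred (p : psym L) : (forall i, term P G (@psrc R L p i)) -> formula P G
| fconn k (c : 'rV[R]_k -> R) :
    continuous c -> ('I_k -> formula P G) -> formula P G
| fsup (D : domain L) : formula P (D :: G) -> formula P G
| finf (D : domain L) : formula P (D :: G) -> formula P G.

Section semantics.
Context {R : realType} {L : language R} (A : structure L).

Definition elt (D : domain L) : Type :=
  {x : carrier A (tag D) | sdom (tagged D) x}.

Fixpoint env (G : seq (domain L)) : Type :=
  if G is D :: G' then (elt D * env G')%type else unit.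

Fixpoint lookup G s (x : var G s) : env G -> carrier A s :=
  match x in var G s return env G -> carrier A s with
  | vz _ _ => fun e => sval e.1
  | vs _ _ _ y => fun e => lookup y e.2
  end.

Context (P : lsort L -> Type) (v : forall s, P s -> carrier A s).

Fixpoint teval G s (t : term P G s) (e : env G) : carrier A s :=
  match t with
  | tvar _ x => lookup x e
  | tpar _ c => v c
  | tapp _ ts => fint (fun i => teval (ts i) e)
  end.

Fixpoint eval G (phi : formula P G) : env G -> R :=
  match phi with
  | fdist _ t u => fun e => mdist (teval t e) (teval u e)
  | fpred _ ts => fun e => pint (fun i => teval (ts i) e)
  | fconn _ c _ phis => fun e => c (\row_i eval (phis i) e)
  | fsup D psi =>
      fun e => sup (range (fun x : elt D => eval psi ((x, e) : env (D :: G))))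
  | finf D psi =>
      fun e => inf (range (fun x : elt D => eval psi ((x, e) : env (D :: G))))
  end.

End semantics.

Section saturation.
Context {R : realType} {L : language R} (A : structure L).

(* [(phi, r)] stands for the condition [phi = r]. *)
Definition condition (G : seq (domain L)) : Type :=
  (formula (fun s => carrier A s : Type) G * R)%type.

Definition cond_val G (c : condition G) (a : env A G) : R :=
  eval (fun s (x : carrier A s) => x) c.1 a.

Definition realized G (t : set (condition G)) : Prop :=
  exists a : env A G, forall c, t c -> cond_val c a = c.2.

Definition consistent G (t : set (condition G)) : Prop :=
  forall (t0 : set (condition G)) e, finite_set t0 -> t0 `<=` t -> 0 < e ->
  exists a : env A G, forall c, t0 c -> `|cond_val c a - c.2| <= e.

Definition countably_saturated : Prop :=
  forall G (t : set (condition G)), countable t -> consistent t -> realized t.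

End saturation.

Section limn_sup_bounded.
Context {R : realType}.
Implicit Types u v : nat -> R.

Lemma bounded_fun_le u M : (forall n, `|u n| <= M) -> bounded_fun u.
Proof.
move=> uM; exists M; split; first exact: num_real.
by move=> x Mx n _ /=; apply: le_trans (uM n) (ltW Mx).
Qed.

Lemma limn_sup_lt_near u r : bounded_fun u ->
  limn_sup u < r -> \forall n \near \oo, u n < r.
Proof.
move=> bu; rewrite limn_supE// => ltr.
have rgt0 : 0 < r - inf (range (sups u)) by rewrite subr_gt0.
have [|_ [n _ <-] snr] := inf_adherent rgt0 (E := range (sups u)).
  split; last exact: bounded_fun_has_lbound_sups.
  by exists (sups u 0%N), 0%N.
rewrite addrC subrK in snr.
exists n => // m /= nm; apply: le_lt_trans snr.
apply: sup_ubound; last by exists m.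
exact/has_ubound_sdrop/bounded_fun_has_ubound.
Qed.

Lemma limn_sup_le u r : bounded_fun u ->
  (forall e, 0 < e -> \forall n \near \oo, u n <= r + e) -> limn_sup u <= r.
Proof.
move=> bu ur; apply/ler_addgt0Pr => e e0.
have [N _ uN] := ur e e0.
rewrite limn_supE//; apply: (@le_trans _ _ (sups u N)).
  by apply: ge_inf; [exact: bounded_fun_has_lbound_sups|exists N].
apply: ge_sup; first by exists (u N), N => //=.
by move=> _ [m /= Nm <-]; exact: uN.
Qed.

Lemma limn_sup_ge u r : bounded_fun u ->
  (\forall n \near \oo, r <= u n) -> r <= limn_sup u.
Proof.
move=> bu ru; rewrite leNgt; apply/negP => /(limn_sup_lt_near bu) ur.
by have [n []] := filter_ex (filterI ru ur); rewrite leNgt => /negP.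
Qed.

Lemma limn_sup_leD u v e : bounded_fun u -> bounded_fun v ->
  (\forall n \near \oo, u n <= v n + e) -> limn_sup u <= limn_sup v + e.
Proof.
move=> bu bv uv; apply: limn_sup_le => // d d0.
have vd : limn_sup v < limn_sup v + d by rewrite ltrDl.
near=> n.
have h1 : u n <= v n + e by near: n.
have h2 : v n < limn_sup v + d by near: n; exact: limn_sup_lt_near.
by rewrite addrAC; apply: (le_trans h1); rewrite lerD2r ltW.
Unshelve. all: end_near. Qed.

Lemma limn_sup_dist u v e : bounded_fun u -> bounded_fun v ->
  (\forall n \near \oo, `|u n - v n| <= e) ->
  `|limn_sup u - limn_sup v| <= e.
Proof.
move=> bu bv uv; rewrite ler_norml; apply/andP; split.
  rewrite lerBrDr addrC lerBlDr; apply: limn_sup_leD => //.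
  apply: filterS uv => n; rewrite ler_norml => /andP[+ _].
  by rewrite lerBrDr addrC lerBlDr.
rewrite lerBlDr addrC; apply: limn_sup_leD => //.
apply: filterS uv => n; rewrite ler_norml => /andP[_].
by rewrite lerBlDr addrC.
Qed.

Lemma near_diagonal (Q : nat -> nat -> Prop) :
  (forall k, \forall n \near \oo, Q k n) ->
  exists kappa : nat -> nat,
    (forall k, \forall n \near \oo, (k <= kappa n)%N) /\
    (\forall n \near \oo, Q (kappa n) n).
Proof.
move=> hQ; pose kappa n := (\max_(k < n.+1 | `[< Q k n >]) (k : nat))%N.
exists kappa; split => [k|].
  near=> n.
  have kn : (k < n.+1)%N by near: n; exists k.
  rewrite /kappa; apply: (@leq_bigmax_cond _ _ _ (Ordinal kn)).
  by apply/asboolP; rewrite /=; near: n; exact: hQ.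
near=> n.
have h0 : `[< Q (@ord0 n) n >] by apply/asboolP; near: n; exact: hQ.
rewrite /kappa; have [|i /asboolP hi ->] :=
  @eq_bigmax_cond _ (fun k : 'I_n.+1 => `[< Q k n >]) (fun k => k : nat).
  by apply/card_gt0P; exists ord0.
exact: hi.
Unshelve. all: end_near. Qed.

End limn_sup_bounded.

Section reduced_product.
Context {R : realType} {L : language R} (A : nat -> structure L).

Record pseq (s : lsort L) := Pseq {
  pval :> forall n, carrier (A n) s;
  pval_dom : exists D : dom s, forall n, sdom D (pval n)
}.

HB.instance Definition _ s := gen_eqMixin (pseq s).
HB.instance Definition _ s := gen_choiceMixin (pseq s).

Definition in_pdom s (D : dom s) (a : pseq s) : Prop :=
  forall n, sdom D (a n).

Definition ldist s (a b : pseq s) : R :=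
  limn_sup (fun n => mdist (a n) (b n)).

Lemma in_pdom_join s (a b : pseq s) :
  exists D : dom s, in_pdom D a /\ in_pdom D b.
Proof.
have [Da ha] := pval_dom a; have [Db hb] := pval_dom b.
have [D [aD bD]] := dle_directed Da Db.
by exists D; split => n; [exact: sdom_le aD _ (ha n)|exact: sdom_le bD _ (hb n)].
Qed.

Lemma bounded_dist s (a b : pseq s) :
  bounded_fun (fun n => mdist (a n) (b n)).
Proof.
have [D [aD bD]] := in_pdom_join a b.
apply: (@bounded_fun_le _ _ (dbound D)) => n.
by rewrite ger0_norm ?mdist_ge0//; exact: sdom_bounded.
Qed.

Lemma ldist_ge0 s (a b : pseq s) : 0 <= ldist a b.
Proof.
apply: limn_sup_ge; first exact: bounded_dist.
by near=> n; exact: mdist_ge0.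
Unshelve. all: end_near. Qed.

Lemma ldist_near s (a b : pseq s) e :
  ldist a b < e -> \forall n \near \oo, mdist (a n) (b n) < e.
Proof. exact/limn_sup_lt_near/bounded_dist. Qed.

Lemma ldist_le s (a b : pseq s) e :
  (\forall n \near \oo, mdist (a n) (b n) <= e) -> ldist a b <= e.
Proof.
move=> abe; apply: limn_sup_le; first exact: bounded_dist.
by move=> d d0; apply: filterS abe => n /le_trans; apply; rewrite lerDl ltW.
Qed.

Lemma ldistxx s (a : pseq s) : ldist a a = 0.
Proof.
apply/eqP; rewrite eq_le ldist_ge0 andbT; apply: ldist_le.
by near=> n; rewrite mdistxx.
Unshelve. all: end_near. Qed.

Lemma ldist_sym s (a b : pseq s) : ldist a b = ldist b a.
Proof. by congr limn_sup; apply/funext => n; exact: metric_sym. Qed.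

Lemma ldist_triangle s (b a c : pseq s) : ldist a c <= ldist a b + ldist b c.
Proof.
apply/ler_addgt0Pr => e e0; apply: ldist_le; near=> n.
have h1 : mdist (a n) (b n) < ldist a b + e / 2.
  by near: n; apply: ldist_near; rewrite ltrDl divr_gt0.
have h2 : mdist (b n) (c n) < ldist b c + e / 2.
  by near: n; apply: ldist_near; rewrite ltrDl divr_gt0.
rewrite (splitr e) addrACA (le_trans (metric_triangle _ (b n) _))//.
by rewrite lerD// ltW.
Unshelve. all: end_near. Qed.

Definition peq s (a b : pseq s) : bool := ldist a b == 0.

Lemma peq_refl s : reflexive (@peq s).
Proof. by move=> a; rewrite /peq ldistxx. Qed.

Lemma peq_sym s : symmetric (@peq s).
Proof. by move=> a b; rewrite /peq ldist_sym. Qed.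

Lemma peq_trans s : transitive (@peq s).
Proof.
move=> b a c /eqP ab /eqP bc; apply/eqP/le_anti; rewrite ldist_ge0 andbT.
by rewrite (le_trans (ldist_triangle b _ _))// ab bc addr0.
Qed.

Canonical peq_equiv s := EquivRel (@peq s) (@peq_refl s) (@peq_sym s)
  (@peq_trans s).

Definition rp_carrier s := {eq_quot (@peq s)}.

HB.instance Definition _ s := EqQuotient.on (rp_carrier s).
HB.instance Definition _ s := Choice.on (rp_carrier s).

Definition rp_quot s (a : pseq s) : rp_carrier s := \pi_(rp_carrier s) a.

Definition rp_mdist s (x y : rp_carrier s) : R := ldist (repr x) (repr y).

Lemma rp_quotP s (a b : pseq s) : rp_quot a = rp_quot b <-> ldist a b = 0.
Proof.
split => [/eqquotP|ab]; first by move=> /eqP.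
by apply/eqquotP/eqP.
Qed.

Lemma rp_reprK s (x : rp_carrier s) : rp_quot (repr x) = x.
Proof. exact: reprK. Qed.

Lemma ldist_repr s (a : pseq s) : ldist (repr (rp_quot a)) a = 0.
Proof. by apply/rp_quotP; rewrite rp_reprK. Qed.

Lemma rp_mdistE s (a b : pseq s) :
  rp_mdist (rp_quot a) (rp_quot b) = ldist a b.
Proof.
rewrite /rp_mdist; set a' := repr _; set b' := repr _.
have a'a : ldist a' a = 0 by exact: ldist_repr.
have b'b : ldist b' b = 0 by exact: ldist_repr.
apply/le_anti/andP; split.
  rewrite (le_trans (ldist_triangle a _ _))// a'a add0r.
  by rewrite (le_trans (ldist_triangle b _ _))// (ldist_sym b) b'b addr0.
rewrite (le_trans (ldist_triangle a' _ _))// ldist_sym a'a add0r.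
by rewrite (le_trans (ldist_triangle b' _ _))// b'b addr0.
Qed.

Lemma rp_mdistxx s (x : rp_carrier s) : rp_mdist x x = 0.
Proof. exact: ldistxx. Qed.

Lemma rp_mdist_positivity s (x y : rp_carrier s) : rp_mdist x y = 0 -> x = y.
Proof. by move=> /rp_quotP; rewrite !rp_reprK. Qed.

Lemma rp_mdist_sym s (x y : rp_carrier s) : rp_mdist x y = rp_mdist y x.
Proof. exact: ldist_sym. Qed.

Lemma rp_mdist_triangle s (y x z : rp_carrier s) :
  rp_mdist x z <= rp_mdist x y + rp_mdist y z.
Proof. exact: ldist_triangle. Qed.

HB.instance Definition _ s := isMetric.Build R (rp_carrier s)
  (@rp_mdistxx s) (@rp_mdist_positivity s) (@rp_mdist_sym s)
  (@rp_mdist_triangle s).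

Lemma mdist_rpE s (a b : pseq s) :
  mdist (rp_quot a) (rp_quot b) =
  limn_sup (fun n => mdist (a n) (b n)).
Proof. exact: rp_mdistE. Qed.

Definition rp_sdom s (D : dom s) : set (rp_carrier s) :=
  @rp_quot s @` in_pdom D.

Section symbols.
Context {k : nat} {src : 'I_k -> lsort L}.
Implicit Types a b : forall i, pseq (src i).

Lemma choose_doms a : exists D : forall i, dom (src i),
  forall i, in_pdom (D i) (a i).
Proof.
have h i : {D : dom (src i) | in_pdom D (a i)} by apply: cid; exact: pval_dom.
by exists (fun i => sval (h i)) => i; exact: (svalP (h i)).
Qed.

Lemma choose_doms2 a b : exists D : forall i, dom (src i),
  forall i, in_pdom (D i) (a i) /\ in_pdom (D i) (b i).
Proof.
have h i : {D : dom (src i) | in_pdom D (a i) /\ in_pdom D (b i)}.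
  by apply: cid; exact: in_pdom_join.
by exists (fun i => sval (h i)) => i; exact: (svalP (h i)).
Qed.

Lemma ldist_near_all a b e : (forall i, ldist (a i) (b i) < e) ->
  \forall n \near \oo, forall i, mdist (a i n) (b i n) < e.
Proof. by move=> h; apply: filter_forall => i; exact: ldist_near. Qed.

Lemma choose_reps (D : forall i, dom (src i)) (x : forall i, rp_carrier (src i)) :
  (forall i, rp_sdom (D i) (x i)) ->
  exists2 a, (forall i, in_pdom (D i) (a i)) & (forall i, rp_quot (a i) = x i).
Proof.
move=> xD.
have h i : {a : pseq (src i) | in_pdom (D i) a /\ rp_quot a = x i}.
  by apply: cid; have [a aD ax] := xD i; exists a.
by exists (fun i => sval (h i)) => i; have [] := svalP (h i).
Qed.

End symbols.

Lemma pfun_dom f (a : forall i, pseq (@fsrc R L f i)) :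
  exists D : dom (ftgt f), forall n, sdom D (fint (fun i => a i n)).
Proof.
have [D aD] := choose_doms a.
by exists (fdom D) => n; apply: fint_dom => i; exact: aD.
Qed.

Definition pfun f (a : forall i, pseq (@fsrc R L f i)) : pseq (ftgt f) :=
  Pseq (pfun_dom a).

(* Symbols are interpreted on canonical representatives; [rp_fintE] and
   [rp_pintE] state that any representatives give the same result. *)
Definition rp_fint f (x : forall i, rp_carrier (@fsrc R L f i)) :
  rp_carrier (ftgt f) := rp_quot (pfun (fun i => repr (x i))).

Definition rp_pint p (x : forall i, rp_carrier (@psrc R L p i)) : R :=
  limn_sup (fun n => pint (fun i => repr (x i) n)).

Lemma pfun_unif f (D : forall i, dom (@fsrc R L f i)) e a b : 0 < e ->
  (forall i, in_pdom (D i) (a i)) -> (forall i, in_pdom (D i) (b i)) ->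
  (forall i, ldist (a i) (b i) < fmod D e) -> ldist (pfun a) (pfun b) <= e.
Proof.
move=> e0 aD bD ab; apply: ldist_le.
apply: filterS (ldist_near_all ab) => n abn.
by apply: fint_unif abn => // i; [exact: aD|exact: bD].
Qed.

Lemma rp_fintE f (a : forall i, pseq (@fsrc R L f i)) :
  rp_fint (fun i => rp_quot (a i)) = rp_quot (pfun a).
Proof.
apply/rp_quotP/le_anti; rewrite ldist_ge0 andbT.
have [D aD] := choose_doms2 (fun i => repr (rp_quot (a i))) a.
apply/ler_addgt0Pr => e e0; rewrite add0r; apply: (@pfun_unif _ D) => // i.
- by have [] := aD i.
- by have [] := aD i.
- by rewrite ldist_repr fmod_gt0.
Qed.

Lemma bounded_pint p (a : forall i, pseq (@psrc R L p i)) :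
  bounded_fun (fun n => pint (fun i => a i n)).
Proof.
have [D aD] := choose_doms a.
by apply: (@bounded_fun_le _ _ (pbound D)) => n; apply: pint_bounded => i;
  exact: aD.
Qed.

Lemma ppred_unif p (D : forall i, dom (@psrc R L p i)) e a b : 0 < e ->
  (forall i, in_pdom (D i) (a i)) -> (forall i, in_pdom (D i) (b i)) ->
  (forall i, ldist (a i) (b i) < pmod D e) ->
  `|limn_sup (fun n => pint (fun i => a i n)) -
    limn_sup (fun n => pint (fun i => b i n))| <= e.
Proof.
move=> e0 aD bD ab; apply: limn_sup_dist; [exact: bounded_pint..|].
apply: filterS (ldist_near_all ab) => n abn.
by apply: pint_unif abn => // i; [exact: aD|exact: bD].
Qed.

Lemma rp_pintE p (a : forall i, pseq (@psrc R L p i)) :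
  rp_pint (fun i => rp_quot (a i)) = limn_sup (fun n => pint (fun i => a i n)).
Proof.
apply/eqP; rewrite -subr_eq0 -normr_le0; apply/ler_addgt0Pr => e e0; rewrite add0r.
have [D aD] := choose_doms2 (fun i => repr (rp_quot (a i))) a.
apply: (@ppred_unif _ D) => // i.
- by have [] := aD i.
- by have [] := aD i.
- by rewrite ldist_repr pmod_gt0.
Qed.

Lemma rp_sdom_cover s (x : rp_carrier s) : exists D, rp_sdom D x.
Proof.
have [D xD] := pval_dom (repr x).
by exists D, (repr x) => //; exact: rp_reprK.
Qed.

Lemma rp_sdom_nonempty s (D : dom s) : rp_sdom D !=set0.
Proof.
have h n : {x : carrier (A n) s | sdom D x} by apply: cid; exact: sdom_nonempty.
have aD : exists D : dom s, forall n, sdom D (sval (h n)).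
  by exists D => n; exact: (svalP (h n)).
by exists (rp_quot (Pseq aD)), (Pseq aD) => // n; exact: (svalP (h n)).
Qed.

Lemma rp_sdom_le s (D1 D2 : dom s) :
  dle D1 D2 -> rp_sdom D1 `<=` rp_sdom D2.
Proof. by move=> D12 _ [a aD <-]; exists a => // n; exact: sdom_le D12 _ (aD n). Qed.

Lemma rp_sdom_bounded s (D : dom s) (x y : rp_carrier s) :
  rp_sdom D x -> rp_sdom D y -> mdist x y <= dbound D.
Proof.
move=> [a aD <-] [b bD <-]; rewrite mdist_rpE; apply: ldist_le.
by near=> n; exact: sdom_bounded.
Unshelve. all: end_near. Qed.

Lemma rp_sdom_complete s (D : dom s) (u : nat -> rp_carrier s) :
  (forall n, rp_sdom D (u n)) -> cauchy (u @ \oo) ->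
  exists2 l, rp_sdom D l & u @ \oo --> l.
Proof.
move=> uD /cauchy_ballP uC.
have h j : {a : pseq s | in_pdom D a /\ rp_quot a = u j}.
  by apply: cid; have [a aD au] := uD j; exists a.
pose r j := sval (h j).
have rD j : in_pdom D (r j) by have [] := svalP (h j).
have ru j : rp_quot (r j) = u j by have [] := svalP (h j).
pose Q k n := forall ij : 'I_k.+1 * 'I_k.+1,
  mdist (r ij.1 n) (r ij.2 n) < ldist (r ij.1) (r ij.2) + k.+1%:R^-1.
have [k|kappa [kappa_oo kappaQ]] := near_diagonal (Q := Q).
  by apply: filter_forall => ij; apply: ldist_near; rewrite ltrDl invr_gt0.
have bD : exists D : dom s, forall n, sdom D (r (kappa n) n).
  by exists D => n; exact: rD.
exists (rp_quot (Pseq bD)).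
  by exists (Pseq bD) => // n; exact: rD.
apply/cvg_ballP => e e0.
have e20 : 0 < e / 2 by rewrite divr_gt0.
have e40 : 0 < e / 2 / 2 by rewrite divr_gt0.
have [[B1 B2] /= [[N1 _ B1N] [N2 _ B2N]] Bball] := uC _ e40.
pose N := maxn N1 N2.
have NC i j : (N <= i)%N -> (N <= j)%N -> ldist (r i) (r j) < e / 2 / 2.
  rewrite !geq_max => /andP[i1 _] /andP[_ j2].
  have := Bball (u i, u j) (conj (B1N _ i1) (B2N _ j2)).
  by rewrite /= ballEmdist /= -(ru i) -(ru j) mdist_rpE.
exists N => // i /= Ni; rewrite ballEmdist /= -ru mdist_rpE.
apply: (@le_lt_trans _ _ (e / 2)); last by rewrite gtr_pMr// invf_lt1// ltr1n.
apply: (@ldist_le _ (Pseq bD)); near=> n => /=.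
have Qn : Q (kappa n) n by near: n.
have Nn : (N <= kappa n)%N by near: n; exact: kappa_oo.
have iN : (i < (kappa n).+1)%N by rewrite ltnS; near: n; exact: kappa_oo.
have := Qn (Ordinal (ltnSn (kappa n)), Ordinal iN) => /= /ltW/le_trans; apply.
rewrite [leRHS]splitr lerD//; first exact/ltW/NC.
have : ((Num.truncn (e / 2 / 2)^-1).+1 <= kappa n)%N by near: n; exact: kappa_oo.
move=> Kn; rewrite -[leRHS]invrK lef_pV2 ?posrE ?invr_gt0//.
rewrite (le_trans (ltW (truncnS_gt _)))// ler_nat.
exact: leq_trans Kn (leqnSn _).
Unshelve. all: end_near. Qed.

Lemma rp_fint_dom f (D : forall i, dom (@fsrc R L f i))
    (x : forall i, rp_carrier (fsrc i)) :
  (forall i, rp_sdom (D i) (x i)) -> rp_sdom (fdom D) (rp_fint x).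
Proof.
move=> /choose_reps[a aD ax].
have -> : x = fun i => rp_quot (a i) by apply: functional_extensionality_dep.
exists (pfun a); last by rewrite rp_fintE.
by move=> n; apply: fint_dom => i; exact: aD.
Qed.

Lemma rp_fint_unif f (D : forall i, dom (@fsrc R L f i)) e
    (x y : forall i, rp_carrier (fsrc i)) : 0 < e ->
  (forall i, rp_sdom (D i) (x i)) -> (forall i, rp_sdom (D i) (y i)) ->
  (forall i, mdist (x i) (y i) < fmod D e) ->
  mdist (rp_fint x) (rp_fint y) <= e.
Proof.
move=> e0 /choose_reps[a aD ax] /choose_reps[b bD by_].
have -> : x = fun i => rp_quot (a i) by apply: functional_extensionality_dep.
have -> : y = fun i => rp_quot (b i) by apply: functional_extensionality_dep.
move=> xy; rewrite !rp_fintE mdist_rpE; apply: pfun_unif bD _ => // i.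
by have := xy i; rewrite mdist_rpE.
Qed.

Lemma rp_pint_bounded p (D : forall i, dom (@psrc R L p i))
    (x : forall i, rp_carrier (psrc i)) :
  (forall i, rp_sdom (D i) (x i)) -> `|rp_pint x| <= pbound D.
Proof.
move=> /choose_reps[a aD ax].
have -> : x = fun i => rp_quot (a i) by apply: functional_extensionality_dep.
have aB n : `|pint (fun i => a i n)| <= pbound D.
  by apply: pint_bounded => i; exact: aD.
have ba := bounded_pint a.
rewrite rp_pintE ler_norml; apply/andP; split.
  apply: limn_sup_ge => //; near=> n.
  by have := aB n; rewrite ler_norml => /andP[].
apply: limn_sup_le => // e e0; near=> n.
have := aB n; rewrite ler_norml => /andP[_] /le_trans; apply.
by rewrite lerDl ltW.
Unshelve. all: end_near. Qed.

Lemma rp_pint_unif p (D : forall i, dom (@psrc R L p i)) e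
    (x y : forall i, rp_carrier (psrc i)) : 0 < e ->
  (forall i, rp_sdom (D i) (x i)) -> (forall i, rp_sdom (D i) (y i)) ->
  (forall i, mdist (x i) (y i) < pmod D e) ->
  `|rp_pint x - rp_pint y| <= e.
Proof.
move=> e0 /choose_reps[a aD ax] /choose_reps[b bD by_].
have -> : x = fun i => rp_quot (a i) by apply: functional_extensionality_dep.
have -> : y = fun i => rp_quot (b i) by apply: functional_extensionality_dep.
move=> xy; rewrite !rp_pintE; apply: ppred_unif bD _ => // i.
by have := xy i; rewrite mdist_rpE.
Qed.

Definition reduced_product : structure L := {|
  carrier := fun s => rp_carrier s : metricType R;
  sdom := rp_sdom;
  fint := rp_fint;
  pint := rp_pint;
  sdom_cover := rp_sdom_cover;
  sdom_nonempty := rp_sdom_nonempty;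
  sdom_le := rp_sdom_le;
  sdom_bounded := rp_sdom_bounded;
  sdom_complete := rp_sdom_complete;
  fint_dom := rp_fint_dom;
  fint_unif := rp_fint_unif;
  pint_bounded := rp_pint_bounded;
  pint_unif := rp_pint_unif
|}.

(* The direct sum consists of sequences in the sort of the constant 0, and is
   the class of 0 in the reduced product ([direct_sumE]). *)
Lemma ord_of_0 k : k = 0%N -> 'I_k -> False.
Proof. by move=> -> []. Qed.

Definition no_args k (k0 : k = 0%N) (T : 'I_k -> Type) (i : 'I_k) : T i :=
  False_rect _ (ord_of_0 k0 i).

Definition pzero : pseq (ftgt (zero L)) :=
  pfun (no_args (zero_arity L) (fun i => pseq (fsrc i))).

Definition direct_sum : set (pseq (ftgt (zero L))) :=
  [set a | limn_sup (fun n => mdist (a n) (pzero n)) = 0].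

Lemma direct_sumE : direct_sum = [set a | rp_quot a = rp_quot pzero].
Proof. by apply/seteqP; split => a /= /rp_quotP. Qed.

End reduced_product.

(* Main.v *)
Require Import Defs.
From mathcomp Require Import all_boot all_order all_algebra generic_quotient.
From mathcomp Require Import all_classical all_reals all_analysis.
From mathcomp Require Import zify lra.

Set Implicit Arguments.
Unset Strict Implicit.
Unset Printing Implicit Defensive.

Import Order.TTheory GRing.Theory Num.Theory.
Import numFieldNormedType.Exports.

Local Open Scope classical_set_scope.
Local Open Scope ring_scope.

(* Colour the tuples of the [A n] with finitely many colours, the colouring being
   an arbitrary function that may depend on [n].  For every formula and every
   [e > 0] there is a colouring such that the value of the formula at the class
   of a sequence of tuples is determined up to [e] by the set of colours that
   occur infinitely often along the sequence.  For atomic formulas this holds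
   because their values are upper limits of bounded sequences; a quantifier is
   handled by colouring a tuple with the set of colours of its extensions.
   A countable type thus involves only countably many colourings, and a diagonal
   sequence built from approximate solutions can be given, for all these
   colourings at once, the recurrent colours of arbitrarily good approximate
   solutions. *)

(** * Recurrent values of a sequence in a finite type *)

Section recurrent.
Context {T : finType}.
Implicit Types (u : nat -> T) (U : {set T}).

Definition recurrent u : {set T} :=
  [set t | `[< forall N, exists2 n, (N <= n)%N & u n = t >]].

Lemma recurrentP u t :
  reflect (forall N, exists2 n, (N <= n)%N & u n = t) (t \in recurrent u).
Proof. by rewrite inE; exact: asboolP. Qed.

(** There are finitely many colours, and each non-recurrent one is absent from some index on. *)
Lemma near_recurrent u : \forall n \near \oo, u n \in recurrent u.
Proof.
have h t : \forall n \near \oo, u n = t -> t \in recurrent u.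
  have [tu|/recurrentP/existsNP[N hN]] := boolP (t \in recurrent u).
    by near=> n.
  by exists N => // n /= Nn unt; exfalso; apply: hN; exists n.
by apply: filterS (filter_forall _ h) => n /(_ _ erefl).
Unshelve. all: end_near. Qed.

Lemma recurrent_near u t (Q : nat -> Prop) : t \in recurrent u ->
  (\forall n \near \oo, Q n) -> exists2 n, Q n & u n = t.
Proof.
move=> /recurrentP tu [N _ QN]; have [n Nn unt] := tu N.
by exists n => //; exact: QN.
Qed.

Lemma recurrent_eq u U : (\forall n \near \oo, u n \in U) ->
  {in U, forall t N, exists2 n, (N <= n)%N & u n = t} -> recurrent u = U.
Proof.
move=> uU Uu; apply/setP => t; apply/idP/idP => [/recurrent_near/(_ uU)|tU].
  by move=> [n + <-].
exact/recurrentP/Uu.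
Qed.

End recurrent.

(** Lets the recurrent colours of a product colouring determine those of its factors. *)
Lemma recurrent_comp (T T' : finType) (h : T -> T') (u : nat -> T) :
  recurrent (h \o u) = h @: recurrent u.
Proof.
apply: recurrent_eq.
  by apply: filterS (near_recurrent u) => n un; exact: imset_f.
move=> _ /imsetP[t /recurrentP tu ->] N.
by have [n Nn <-] := tu N; exists n.
Qed.

(** The number of earlier visits to [t] grows by steps of at most 1 and is unbounded, so the last
    [n] at which it is at most [r] is a visit with rank exactly [r]. *)
Lemma recurrent_rank (T : finType) (u : nat -> T) t : t \in recurrent u ->
  forall r, exists2 n, u n = t & (\sum_(m < n) (u m == t))%N = r.
Proof.
move=> /recurrentP tu r.
pose rk n := (\sum_(m < n) (u m == t))%N.
have rkS n : rk n.+1 = (rk n + (u n == t))%N by rewrite /rk big_ord_recr.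
have rk_mono m n : (m <= n)%N -> (rk m <= rk n)%N.
  move=> /subnK <-; elim: (n - m)%N => // k IH.
  by rewrite addSn rkS (leq_trans IH)// leq_addr.
have unbounded k : exists n, (k <= rk n)%N.
  elim: k => [|k [n kn]]; first by exists 0%N.
  have [m nm umt] := tu n; exists m.+1.
  by rewrite rkS umt eqxx addn1 ltnS (leq_trans kn)// rk_mono.
have [N rN] := unbounded r.+1.
have bounded n : (rk n <= r)%N -> (n <= N)%N.
  by move=> nr; rewrite leqNgt; apply/negP => /ltnW/rk_mono; lia.
have rk0 : exists n, (rk n <= r)%N by exists 0%N; rewrite /rk big_ord0.
have [n nr nmax] := ex_maxnP rk0 bounded.
have : (r < rk n.+1)%N by rewrite ltnNge; apply/negP => /nmax; rewrite ltnn.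
rewrite rkS; exists n; first by apply/eqP; lia.
by rewrite -/(rk n); lia.
Qed.

(* The value at [n] runs cyclically through [V (u n)], driven by the number of
   earlier visits of [u] to [u n]. *)
Lemma recurrent_choice (S T : finType) (u : nat -> S) (V : S -> {set T}) :
  {in recurrent u, forall s, V s != finset.set0} ->
  exists2 w : nat -> T, \forall n \near \oo, w n \in V (u n) &
    forall s t, s \in recurrent u -> t \in V s ->
      forall N, exists2 n, (N <= n)%N & u n = s /\ w n = t.
Proof.
move=> V0.
have [s0 s0u] : exists s, s \in recurrent u.
  by have [n] := filter_ex (near_recurrent u); exists (u n).
have [t0 _] := set0Pn _ (V0 _ s0u).
pose rk n := (\sum_(m < n) (u m == u n))%N.
pose w n := nth t0 (enum (V (u n))) (rk n %% #|V (u n)|).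
exists w.
  apply: filterS (near_recurrent u) => n /V0; rewrite -card_gt0 => un0.
  by rewrite -mem_enum mem_nth// -cardE ltn_mod.
move=> s t su tV N.
pose i := index t (enum (V s)).
(* The residue [i] of the rank modulo [#|V s|] selects [t]; since the rank is at most [n] and [V s]
   is nonempty, the multiple [N * #|V s|] forces [N <= n]. *)
have [n uns rkn] := recurrent_rank su (N * #|V s| + i)%N.
have Vs : (0 < #|V s|)%N by apply/card_gt0P; exists t.
have rkE : rk n = (N * #|V s| + i)%N by rewrite -rkn /rk uns.
exists n; last split => //.
  have : (rk n <= n)%N.
    rewrite /rk -[leqRHS]card_ord -sum1_card leq_sum// => m _.
    by case: (_ == _).
  by rewrite rkE; nia.
rewrite /w uns rkE modnMDl modn_small ?nth_index ?mem_enum//.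
by rewrite cardE index_mem mem_enum.
Qed.

(** * Diagonal sequences for countably many colourings *)

Section diagonal.
Context {E : nat -> Type} {T : nat -> finType}.
Context (c : forall k n, E n -> T k) (a : nat -> forall n, E n).

(* An ultrafilter selects for every colouring [c k] a set [U k] of recurrent
   colours shared by a large set of the [a j].  Given [b j] among them with
   recurrent colours [U k] for all [k <= j], the sequence [e] follows [b j] on a
   block so long that all the colours of [U k], [k <= j], are visited. *)
Lemma recurrent_diagonal : exists e : forall n, E n, forall k N,
  exists2 j, (N <= j)%N &
    recurrent (fun n => c k (e n)) = recurrent (fun n => c k (a j n)).
Proof.
pose V j k := recurrent (fun n => c k (a j n)).
have [G [GU ooG]] := ultraFilterLemma eventually_filter.
(* Pigeonhole: if no value of [V j k] had a large fibre, [G] would contain the complements of all of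
   these finitely many fibres, whose intersection is empty. *)
have hU k : {U | G [set j | V j k = U]}.
  apply: cid; apply: contrapT => /forallNP nG.
  have {}nG U : G [set j | V j k <> U].
    by have [/nG|] := in_ultra_setVsetC [set j | V j k = U] GU.
  by have [j /(_ (V j k))] := filter_ex (filter_forall _ nG).
pose U k := sval (hU k).
have hb j : {i | (j <= i)%N & forall k : 'I_j.+1, V i k = U k}.
  apply: cid2.
  have GVU : G (fun i => forall k : 'I_j.+1, V i k = U k).
    by apply: filter_forall => k; exact: (svalP (hU k)).
  have Gj : G (fun i => (j <= i)%N) by apply: ooG; exists j.
  by have [i [ji iV]] := filter_ex (filterI Gj GVU); exists i.
pose b j := a (s2val (hb j)).
pose good j n := forall k : 'I_j.+1, c k (b j n) \in U k.
pose visited j N N' := forall (k : 'I_j.+1) t, t \in U k ->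
  exists2 n, (N <= n < N')%N & c k (b j n) = t.
have near_good j : \forall n \near \oo, good j n.
  apply: filter_forall => k; rewrite -(s2valP' (hb j) k).
  exact: near_recurrent.
have near_visited j N : \forall N' \near \oo, visited j N N'.
  apply: filter_forall => k; apply: filter_forall => t.
  have [tU|tU] := boolP (t \in U k); last by near=> N'.
  have [n Nn nt] : exists2 n, (N <= n)%N & c k (b j n) = t.
    by move: tU; rewrite -(s2valP' (hb j) k) => /recurrentP.
  by exists n.+1 => // N' /= nN' _; exists n; rewrite ?Nn.
have h0 : {N | forall n, (N <= n)%N -> good 0%N n}.
  by apply: cid; have [N _ hN] := near_good 0%N; exists N.
(* The end of a block lies late enough for [b j] to have visited its colours and for [b j.+1] to
   show only colours of [U] from there on. *)
have hS j N : {N' | [/\ (N < N')%N, visited j N N' &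
    forall n, (N' <= n)%N -> good j.+1 n]}.
  apply: cid; have [N1 _ hN1] := near_good j.+1.
  have [N2 _ hN2] := near_visited j N.
  exists (N.+1 + N1 + N2)%N; split; [lia|apply: hN2 => /=; lia|].
  by move=> n Nn; apply: hN1 => /=; lia.
pose B := fix B j := if j is j'.+1 then sval (hS j' (B j')) else sval h0.
have BS j : (B j < B j.+1)%N by have [] := svalP (hS j (B j)).
have B_visited j : visited j (B j) (B j.+1) by have [] := svalP (hS j (B j)).
have B_good j n : (B j <= n)%N -> good j n.
  case: j => [|j]; first exact: (svalP h0).
  by have [_ _] := svalP (hS j (B j)); exact.
have B_mono i j : (i <= j)%N -> (B i <= B j)%N.
  move=> /subnK <-; elim: (j - i)%N => // k IH.
  by rewrite addSn (leq_trans IH)// ltnW.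
have B_ge j : (j <= B j)%N by elim: j => // j IH; exact: leq_ltn_trans IH (BS j).
(* Before [B 0] the block number is arbitrary; these finitely many indices do not affect
   recurrence. *)
have hblock n : {j | (B 0 <= n)%N -> (B j <= n < B j.+1)%N}.
  apply: cid; have [B0|] := leqP (B 0%N) n; last by exists 0%N.
  have bounded j : (B j <= n)%N -> (j <= n)%N by exact: leq_trans.
  have [j Bj jmax] := ex_maxnP (ex_intro (fun j => B j <= n)%N 0%N B0) bounded.
  exists j => _; rewrite Bj ltnNge; apply/negP => /jmax.
  by rewrite ltnn.
pose block n := sval (hblock n).
have blockE j n : (B j <= n < B j.+1)%N -> block n = j.
  move=> /andP[jn nj].
  have /(svalP (hblock n)) : (B 0 <= n)%N by exact: leq_trans (B_mono 0%N j _) jn.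
  rewrite -/(block n) => /andP[bn nb]; apply/eqP; rewrite eqn_leq.
  by apply/andP; split; rewrite leqNgt; apply/negP => /B_mono; lia.
exists (fun n => b (block n) n) => k N.
exists (s2val (hb (maxn k N))).
  exact: leq_trans (leq_maxr _ _) (s2valP (hb _)).
have kmax : (k < (maxn k N).+1)%N by rewrite ltnS leq_maxl.
rewrite [RHS](s2valP' (hb (maxn k N)) (Ordinal kmax)) /=.
apply: recurrent_eq.
  exists (B k) => // n /= kn.
  have /(svalP (hblock n)) : (B 0 <= n)%N by exact: leq_trans (B_mono 0%N k _) kn.
  rewrite -/(block n) => /andP[bn nb].
  have kb : (k < (block n).+1)%N.
    by rewrite ltnNge; apply/negP => /B_mono; lia.
  exact: (B_good _ _ bn (Ordinal kb)).
move=> t tU N'.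
(* Block number [maxn k N'] handles the colouring [k] and starts beyond [N'], because [B j] is at
   least [j]. *)
have kmax' : (k < (maxn k N').+1)%N by rewrite ltnS leq_maxl.
have [n nB nt] := B_visited (maxn k N') (Ordinal kmax') t tU.
exists n; last by rewrite (blockE _ _ nB).
case/andP: nB => + _; apply: leq_trans.
exact: leq_trans (leq_maxr k N') (B_ge _).
Unshelve. all: end_near. Qed.

End diagonal.

(** * Functions of sequences determined by recurrent colours *)

(** Compactness of the box makes the local radii of continuity uniform. Only [x] has to lie in the
    box. *)
Lemma continuous_unif_on_box (R : realType) k (c : 'rV[R]_k -> R)
    (B : 'I_k -> R) (e : R) :
  continuous c -> 0 < e -> exists2 d, 0 < d &
    forall x y : 'rV[R]_k, (forall i, `|x ord0 i| <= B i) ->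
      (forall i, `|x ord0 i - y ord0 i| < d) -> `|c x - c y| <= e.
Proof.
move=> cc e0.
pose K := [set x : 'rV[R]_k | forall i, `[- B i, B i]%classic (x ord0 i)].
have /compact_near_coveringP K_cover : compact K.
  apply: (@rV_compact R k (fun i => `[- B i, B i]%classic)) => i.
  exact: segment_compact.
pose P (d : R) (x : 'rV[R]_k) := forall y, ball x d y -> `|c x - c y| <= e.
have : \forall d \near 0^'+, K `<=` P d.
  apply: (K_cover _ _ P) => x _.
  have e20 : 0 < e / 2 by rewrite divr_gt0.
  have /cvgrPdist_lt/(_ _ e20)/nbhs_ballP[d /= d0 xd] := cc x.
  have d20 : 0 < d / 2 by rewrite divr_gt0.
  exists (ball x (d / 2), [set t | t < d / 2]) => /=.
    by split; [exact: nbhsx_ballx|exact: nbhs_right_lt].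
  move=> [x' t] /= [xx' td] y x'y.
  have /xd h1 : ball x d x'.
    by apply: le_ball xx'; rewrite ler_pdivrMr//; lra.
  have /xd h2 : ball x d y.
    rewrite (splitr d); apply: ball_triangle xx' _.
    by apply: le_ball x'y; exact: ltW.
  rewrite -(subrKA (c x)) (splitr e) (le_trans (ler_normD _ _))//.
  by rewrite lerD// ltW// distrC.
move=> KP.
have [d [KPd d0]] := @filter_ex _ _ (at_right_proper_filter (0 : R)) _
  (filterI KP (nbhs_right_gt 0)).
exists d => // x y xB xyd; apply: KPd.
  by move=> i /=; rewrite in_itv/= -ler_norml.
by split=> // i j; rewrite (ord1 i); exact: xyd.
Qed.

Lemma bounded_has_sup_has_inf (R : realType) (X : set R) B : X !=set0 ->
  (forall x, X x -> `|x| <= B) -> has_sup X /\ has_inf X.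
Proof.
move=> X0 XB; split; split => //.
- by exists B => x /XB; rewrite ler_norml => /andP[].
- by exists (- B) => x /XB; rewrite ler_norml => /andP[].
Qed.

Section tame.
Context {R : realType}.

Definition tame (E : nat -> Type) (f : (forall n, E n) -> R) : Prop :=
  forall e : R, 0 < e -> exists (T : finType) (c : forall n, E n -> T),
    forall a b, recurrent (fun n => c n (a n)) = recurrent (fun n => c n (b n)) ->
    `|f a - f b| <= e.

(** At precision 1 there are finitely many possible sets of recurrent colours, and [f] varies by at
    most 1 among the sequences sharing one of them. *)
Lemma tame_bounded E (f : (forall n, E n) -> R) : tame f ->
  exists B, forall a, `|f a| <= B.
Proof.
move=> /(_ _ ltr01)[T [c fc]].
have h (U : {set T}) : {B | forall a, recurrent (fun n => c n (a n)) = U ->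
    `|f a| <= B}.
  apply: cid; have [[a0 a0U]|nU] :=
    pselect (exists a, recurrent (fun n => c n (a n)) = U).
    exists (1 + `|f a0|) => a aU.
    rewrite -[f a](subrK (f a0)) (le_trans (ler_normD _ _))// lerD2r.
    by apply: fc; rewrite aU.
  by exists 0 => a aU; exfalso; apply: nU; exists a.
exists (\sum_(U : {set T}) `|sval (h U)|) => a.
apply: (le_trans (svalP (h _) a erefl)); rewrite (le_trans (ler_norm _))//.
by rewrite (bigD1 (recurrent (fun n => c n (a n))))//= lerDl sumr_ge0.
Qed.

(** The colour of [x] is the index of the interval of length [e] in a subdivision of [[-B, B]] that
    contains [g n x]. A late colour along [a] recurs along [b], also where [g] barely exceeds the
    upper limit for [b] at most. *)
Lemma tame_limn_sup (E : nat -> Type) (g : forall n, E n -> R) (B : R) :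
  (forall n x, `|g n x| <= B) -> tame (fun a => limn_sup (fun n => g n (a n))).
Proof.
move=> gB e e0.
pose m := Num.truncn (2 * B / e).
pose c n (x : E n) : 'I_m.+1 := inord (Num.truncn ((g n x + B) / e)).
have c_ge0 n x : 0 <= (g n x + B) / e.
  have := gB n x; rewrite ler_norml => /andP[gx _].
  by apply: divr_ge0 (ltW e0); lra.
have cE n x : c n x = Num.truncn ((g n x + B) / e) :> nat.
  rewrite inordK// ltnS /m le_truncn// ler_pM2r ?invr_gt0//.
  by have := gB n x; rewrite ler_norml => /andP[_ ?]; lra.
have c_close n x n' x' : c n x = c n' x' -> g n x <= g n' x' + e.
  move=> /(congr1 val); rewrite /= !cE => cc.
  have /andP[_] := truncn_itv (c_ge0 n x).
  have /andP[+ _] := truncn_itv (c_ge0 n' x').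
  by rewrite -cc ler_pdivlMr// ltr_pdivrMr// -natr1; lra.
have gb (a : forall n, E n) : bounded_fun (fun n => g n (a n)).
  exact: (@bounded_fun_le _ _ B).
have le_lim a b : recurrent (fun n => c n (a n)) = recurrent (fun n => c n (b n)) ->
    limn_sup (fun n => g n (a n)) <= limn_sup (fun n => g n (b n)) + e.
  move=> ab; apply: limn_sup_le => // d d0.
  apply: filterS (near_recurrent (fun n => c n (a n))) => n.
  have lim_lt : limn_sup (fun n => g n (b n)) < limn_sup (fun n => g n (b n)) + d.
    by rewrite ltrDl.
  rewrite ab => /recurrent_near/(_ (limn_sup_lt_near (gb b) lim_lt))[k bk].
  move=> /esym/c_close/le_trans; apply.
  by rewrite addrAC lerD2r ltW.
exists 'I_m.+1, c => a b ab.
by rewrite ler_distl le_lim// lerBlDr le_lim.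
Qed.

(** The values of the [f i] lie in a box on which [c] is uniformly continuous, so the product of
    sufficiently fine colourings for the [f i] works. *)
Lemma tame_connective (E : nat -> Type) k (c : 'rV[R]_k -> R)
    (f : 'I_k -> (forall n, E n) -> R) :
  continuous c -> (forall i, tame (f i)) -> tame (fun a => c (\row_i f i a)).
Proof.
move=> cc ft e e0.
have hB i : {B | forall a, `|f i a| <= B} by apply/cid/tame_bounded.
have [d d0 cd] := continuous_unif_on_box (fun i => sval (hB i)) cc e0.
have d20 : 0 < d / 2 by rewrite divr_gt0.
have hT i := cid (ft i _ d20).
have hc i := cid (svalP (hT i)).
pose T : finType := {dffun forall i, sval (hT i)}.
exists T, (fun n x => [ffun i => sval (hc i) n x]) => a b ab.
apply: cd => i; rewrite !mxE; first exact: (svalP (hB i)).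
apply: (@le_lt_trans _ _ (d / 2)); last by rewrite ltr_pdivrMr//; lra.
apply: (svalP (hc i)).
(* Projecting the product colours to coordinate [i] gives equal recurrent sets for the [i]-th
   colouring. *)
have := congr1 (fun U : {set T} => [set (t : T) i | t in U]%SET) ab.
rewrite -!recurrent_comp; congr (_ = _); congr recurrent;
  by apply/funext => n /=; rewrite ffunE.
Qed.

Section quantifiers.
Context {E F : nat -> Type} (y0 : forall n, F n).
Context (f : (forall n, F n * E n) -> R).

(* The colour of [x] is the set of colours taken by the pairs [(y, x)].  Two
   sequences with the same recurrent colours are then interchangeable: a witness
   [y] for [a] can be simulated along [b], because every recurrent set of
   colours occurs infinitely often, leaving room for all its elements. *)
Lemma tame_simulation : tame f ->
  forall e : R, 0 < e -> exists (T : finType) (c : forall n, E n -> T),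
    forall a b, recurrent (fun n => c n (a n)) = recurrent (fun n => c n (b n)) ->
    forall y, exists y', `|f (fun n => (y n, a n)) - f (fun n => (y' n, b n))| <= e.
Proof.
move=> ft e e0; have [T [c fc]] := ft _ e0.
pose C n (x : E n) : {set T} := [set t | `[< exists y, c n (y, x) = t >]]%SET.
have CP n x t : reflect (exists y, c n (y, x) = t) (t \in C n x).
  by rewrite inE; exact: asboolP.
exists {set T}, C => a b ab y.
pose U := recurrent (fun n => c n (y n, a n)).
have nearU : \forall n \near \oo, c n (y n, a n) \in U by exact: near_recurrent.
(* A colour recurrent along [b] recurs along [a], in particular at late indices, where the witness
   [y] provides an element of [U]. *)
have C0 : {in recurrent (fun n => C n (b n)), forall S, S :&: U != finset.set0}.
  move=> S; rewrite -ab => /recurrent_near/(_ nearU)[n cU <-].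
  by apply/set0Pn; exists (c n (y n, a n)); rewrite finset.in_setI cU andbT; apply/CP; exists (y n).
have [w wC w_visits] := recurrent_choice C0.
(* The default [y0] occurs only at finitely many [n], as [w n] is eventually a colour of an
   extension of [b n]. *)
have h n : {z : F n | w n \in C n (b n) -> c n (z, b n) = w n}.
  apply: cid; have [/CP[z zw]|wn] := boolP (w n \in C n (b n)); first by exists z.
  by exists (y0 n).
exists (fun n => sval (h n)); apply: fc; apply/esym/recurrent_eq.
  apply: filterS wC => n; rewrite finset.in_setI => /andP[/(svalP (h n)) -> +].
  exact.
move=> t tU N.
have [n /= Sb cnt] := recurrent_near tU (near_recurrent (fun n => C n (a n))).
rewrite ab in Sb.
have tS : t \in C n (a n) :&: U by rewrite finset.in_setI tU andbT; apply/CP; exists (y n).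
have [m Nm [Cm wm]] := w_visits _ _ Sb tS N.
exists m => //; rewrite (svalP (h m)) //.
by rewrite wm Cm; move: tS; rewrite finset.in_setI => /andP[].
Qed.

Let values a := range (fun y : forall n, F n => f (fun n => (y n, a n))).

Let values_has_sup_inf : tame f -> forall a, has_sup (values a) /\ has_inf (values a).
Proof.
move=> /tame_bounded[B fB] a; apply: (@bounded_has_sup_has_inf _ _ B).
  by exists (f (fun n => (y0 n, a n))), y0.
by move=> _ [y _ <-].
Qed.

Lemma tame_sup : tame f ->
  tame (fun a => sup (range (fun y : forall n, F n => f (fun n => (y n, a n))))).
Proof.
move=> ft e e0; have [T [c fc]] := tame_simulation ft e0.
have bnd a : has_sup (values a) by case: (values_has_sup_inf ft a).
have sup_leD a b : recurrent (fun n => c n (a n)) = recurrent (fun n => c n (b n)) ->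
    sup (values a) <= sup (values b) + e.
  move=> ab; apply: ge_sup; first by case: (bnd a).
  move=> _ [y _ <-]; have [y' yy'] := fc _ _ ab y.
  rewrite -lerBlDr; apply: (@le_trans _ _ (f (fun n => (y' n, b n)))).
    by move: yy'; rewrite ler_distl => /andP[_]; rewrite lerBlDr.
  by apply: sup_ubound; [case: (bnd b)|exists y'].
exists T, c => a b ab.
by rewrite ler_distl sup_leD// lerBlDr sup_leD.
Qed.

Lemma tame_inf : tame f ->
  tame (fun a => inf (range (fun y : forall n, F n => f (fun n => (y n, a n))))).
Proof.
move=> ft e e0; have [T [c fc]] := tame_simulation ft e0.
have bnd a : has_inf (values a) by case: (values_has_sup_inf ft a).
have inf_leD a b : recurrent (fun n => c n (a n)) = recurrent (fun n => c n (b n)) ->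
    inf (values a) <= inf (values b) + e.
  move=> ab; rewrite -lerBlDr; apply: lb_le_inf; first by case: (bnd b).
  (* For infima the witness for [b] is simulated along [a]. *)
  move=> _ [y _ <-]; have [y' yy'] := fc _ _ (esym ab) y.
  rewrite lerBlDr; apply: (@le_trans _ _ (f (fun n => (y' n, a n)))).
    by apply: ge_inf; [case: (bnd a)|exists y'].
  by move: yy'; rewrite distrC ler_distl => /andP[_].
exists T, c => a b ab.
by rewrite ler_distl inf_leD// lerBlDr inf_leD.
Qed.

End quantifiers.
End tame.

(** * Evaluation in the reduced product *)

Definition elt_inhabitant (R : realType) (L : language R) (B : structure L)
  (D : domain L) : elt B D := cid (sdom_nonempty B (tagged D)).

Section evaluation.
Context {R : realType} {L : language R} (A : nat -> structure L).

Notation M := (reduced_product A).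
Notation param := (fun s : lsort L => carrier M s : Type).
Notation meval := (Defs.eval (A := M) (P := param) (fun s x => x)).
Notation mteval := (teval (A := M) (P := param) (fun s x => x)).

Lemma rp_quot_ext s (a b : pseq A s) :
  (forall n, a n = b n) -> rp_quot a = rp_quot b.
Proof.
move=> ab; apply/rp_quotP; rewrite -(ldistxx b); congr limn_sup.
by apply/funext => n; rewrite ab.
Qed.

Section elements.
Context (D : domain L).
Implicit Types (x : forall n, elt (A n) D).

Definition elt_pseq x : pseq A (tag D) :=
  Pseq (ex_intro (fun D' => forall n, sdom D' (sval (x n))) (tagged D)
    (fun n => svalP (x n))).

Lemma elt_class_dom x : @sdom R L M _ (tagged D) (rp_quot (elt_pseq x)).
Proof. by exists (elt_pseq x) => // n; exact: (svalP (x n)). Qed.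

Definition elt_class x : elt M D := exist _ _ (elt_class_dom x).

Lemma elt_class_surj (z : elt M D) : exists x, elt_class x = z.
Proof.
case: z => z zD; have [a aD az] := zD.
exists (fun n => exist _ (a n) (aD n)); apply: eq_exist => /=.
by rewrite -az; exact: rp_quot_ext.
Qed.

End elements.

Fixpoint env_class G : (forall n, env (A n) G) -> env M G :=
  if G is D :: G' return (forall n, env (A n) G) -> env M G then
    fun e => (elt_class (fun n => (e n).1), env_class (fun n => (e n).2))
  else fun _ => tt.

Lemma env_class_surj G (e : env M G) : exists a, env_class a = e.
Proof.
elim: G e => [[]|D G IH [x e]]; first by exists (fun=> tt).
have [y <-] := elt_class_surj x; have [a <-] := IH e.
by exists (fun n => (y n, a n)).
Qed.

Definition rp_val n s (x : param s) : carrier (A n) s := repr (x : rp_carrier A s) n.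

(** The domain is independent of [n] and of the environment, since variables range over fixed
    domains and parameters are represented by sequences in one domain. This yields the uniform
    bounds needed for atomic formulas. *)
Lemma teval_dom G s (t : term param G s) :
  exists D : dom s, forall n (e : env (A n) G), sdom D (teval (@rp_val n) t e).
Proof.
elim: t => {s} [s x|s x|f ts IH].
- elim: x => {G s} [D G|D G s x [D' IH]].
    by exists (tagged D) => n e; exact: (svalP e.1).
  by exists D' => n e; exact: IH.
- by have [D xD] := pval_dom (repr (x : rp_carrier A s)); exists D.
- have h i := cid (IH i).
  exists (fdom (fun i => sval (h i))) => n e.
  by apply: fint_dom => i; exact: (svalP (h i)).
Qed.

Lemma teval_seq_dom G (e : forall n, env (A n) G) s (t : term param G s) :
  exists D : dom s, forall n, sdom D (teval (@rp_val n) t (e n)).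
Proof. by have [D tD] := teval_dom t; exists D. Qed.

Definition teval_pseq G (e : forall n, env (A n) G) s (t : term param G s) :
  pseq A s := Pseq (teval_seq_dom e t).

Lemma lookup_class G s (x : var G s) (e : forall n, env (A n) G) :
  lookup x (env_class e) = rp_quot (teval_pseq e (tvar param x)).
Proof.
elim: x e => {G s} [D G|D G s x IH] e /=; first exact: rp_quot_ext.
by rewrite IH; exact: rp_quot_ext.
Qed.

Lemma teval_class G (e : forall n, env (A n) G) s (t : term param G s) :
  mteval t (env_class e) = rp_quot (teval_pseq e t).
Proof.
elim: t => {s} [s x|s x|f ts IH] /=; first exact: lookup_class.
- by rewrite -[LHS]rp_reprK; exact: rp_quot_ext.
- transitivity (rp_fint (fun i => rp_quot (teval_pseq e (ts i)))).
    by congr rp_fint; exact: functional_extensionality_dep.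
  by rewrite rp_fintE; exact: rp_quot_ext.
Qed.

(** Induction on the formula. Every element of a domain of the reduced product is the class of a
    sequence in that domain, so its quantifiers become suprema and infima over sequences. *)
Lemma tame_eval G (phi : formula param G) :
  tame (fun e : forall n, env (A n) G => meval phi (env_class e)).
Proof.
elim: phi => {G} [G s t u|G p ts|G k c cc phis IH|G D psi IH|G D psi IH] /=.
- rewrite [X in tame X](_ : _ = fun e : forall n, env (A n) G =>
    limn_sup (fun n => mdist (teval (@rp_val n) t (e n)) (teval (@rp_val n) u (e n)))).
    have [Dt tD] := teval_dom t; have [Du uD] := teval_dom u.
    have [D [tuD utD]] := dle_directed Dt Du.
    apply: (@tame_limn_sup _ _ (fun n x => mdist (teval (@rp_val n) t x)
      (teval (@rp_val n) u x)) (dbound D)) => n x.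
    rewrite ger0_norm ?mdist_ge0//; apply: sdom_bounded.
      exact: sdom_le tuD _ (tD _ _).
    exact: sdom_le utD _ (uD _ _).
  by apply/funext => e; rewrite !teval_class; exact: mdist_rpE.
- rewrite [X in tame X](_ : _ = fun e : forall n, env (A n) G =>
    limn_sup (fun n => pint (fun i => teval (@rp_val n) (ts i) (e n)))).
    have h i := cid (teval_dom (ts i)).
    apply: (@tame_limn_sup _ _ (fun n x => pint (fun i => teval (@rp_val n) (ts i) x))
      (pbound (fun i => sval (h i)))) => n x.
    by apply: pint_bounded => i; exact: (svalP (h i)).
  apply/funext => e.
  transitivity (rp_pint (fun i => rp_quot (teval_pseq e (ts i)))).
    congr rp_pint; apply: functional_extensionality_dep => i.
    exact: teval_class.
  by rewrite rp_pintE.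
- exact: tame_connective.
- rewrite [X in tame X](_ : _ = fun e : forall n, env (A n) G =>
    sup (range (fun y : forall n, elt (A n) D =>
      meval psi (env_class (G := D :: G) (fun n => (y n, e n)))))).
    exact: (tame_sup (fun n => elt_inhabitant (A n) D) IH).
  apply/funext => e; congr sup; apply/seteqP; split => [_ [z _ <-]|_ [y _ <-]].
    by have [y <-] := elt_class_surj z; exists y.
  by exists (elt_class y).
- rewrite [X in tame X](_ : _ = fun e : forall n, env (A n) G =>
    inf (range (fun y : forall n, elt (A n) D =>
      meval psi (env_class (G := D :: G) (fun n => (y n, e n)))))).
    exact: (tame_inf (fun n => elt_inhabitant (A n) D) IH).
  apply/funext => e; congr inf; apply/seteqP; split => [_ [z _ <-]|_ [y _ <-]].
    by have [y <-] := elt_class_surj z; exists y.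
  by exists (elt_class y).
Qed.

End evaluation.

(** * Countable saturation *)

Theorem theorem1p5 (R : realType) (L : language R) (A : nat -> structure L) :
  countably_saturated (reduced_product A).
Proof.
move=> G t ct tcons.
have [t0|[cond]] := pfcard_geP ct.
  have [a _] := tcons set0 1 (finite_set0 _) (@sub0set _ _) ltr01.
  by exists a => c; rewrite t0.
(* Consistency, lifted to sequences: the [j]-th one satisfies conditions [0] to [j] up to
   [1/(j+1)]. *)
have h j : {a : forall n, env (A n) G | forall i : nat, (i <= j)%N ->
    `|cond_val (cond i) (env_class a) - (cond i).2| <= j.+1%:R^-1}.
  apply: cid.
  have [|||z zj] := tcons (cond @` `I_j.+1) j.+1%:R^-1.
  - exact/finite_image/finite_II.
  - by move=> _ [i _ <-]; exact: funS.
  - by rewrite invr_gt0.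
  have [a az] := env_class_surj z; exists a => i ij.
  by rewrite az; apply: zj; exists i.
(* The number [k] codes a pair [(i, m)]: the colouring [k] determines the formula of condition [i]
   up to [1/(m+1)]. Numbers that are not codes are sent to [(0, 0)]. *)
pose dec k : nat * nat := odflt (0%N, 0%N) (unpickle k).
have inv_gt0 m : 0 < m.+1%:R^-1 :> R by rewrite invr_gt0.
have hc k := cid (tame_eval (cond (dec k).1).1 (inv_gt0 (dec k).2)).
have hc' k := cid (svalP (hc k)).
have [e e_diag] := recurrent_diagonal (fun k => sval (hc' k)) (fun j => sval (h j)).
exists (env_class e) => _ /(@surj _ _ _ _ cond)[i _ <-].
apply/eqP; rewrite -subr_eq0 -normr_le0; apply/ler_addgt0Pr => d d0; rewrite add0r.
(* The error [d] is split evenly between the colouring of precision [1/(m+1)] and the approximate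
   solution [j], where [j] is at least [m]. *)
pose m := Num.truncn (d / 2)^-1.
have md j : (m <= j)%N -> j.+1%:R^-1 <= d / 2.
  move=> mj; rewrite -[leRHS]invrK lef_pV2 ?posrE ?invr_gt0 ?divr_gt0//.
  by rewrite (le_trans (ltW (truncnS_gt _)))// ler_nat.
have decE : dec (pickle (i, m)) = (i, m) by rewrite /dec pickleK.
have [j ij ej] := e_diag (pickle (i, m)) (maxn i m).
have := svalP (hc' (pickle (i, m))) _ _ ej; rewrite decE /= => h1.
have h2 := svalP (h j) i (leq_trans (leq_maxl _ _) ij).
rewrite (splitr d) -(subrKA (cond_val (cond i) (env_class (sval (h j))))).
rewrite (le_trans (ler_normD _ _))// lerD//.
  exact: le_trans h1 (md _ (leqnn _)).
exact: le_trans h2 (md _ (leq_trans (leq_maxr _ _) ij)).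
Qed.
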